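(* Let $0<a<1$, $\alpha\in(0,1]$ and $b=a^{1/\alpha}$. Let $\{X(t),t\ge 0\}$ be a Lévy process taking values in $I_0=\{0,1,2,\dots\}$. Then $\{X(t)\}$ is $I_0$-valued $(a,\tfrac{1}{\alpha})$-semi-selfsimilar if and only if the distribution of $X(1)$ is $I_0$-valued (discrete) semi-stable$(a,b)$.
   Context: A Lévy process is a process with stationary and independent increments and $X(0)=0$; if $P(s)$ is the probability generating function (PGF) of $X(1)$ then the PGF of $X(t)$ is $P(s)^t$. Binomial thinning: for $0<c<1$ and an $I_0$-valued random variable $X$, $c\otimes X=\sum_{i=1}^{X} Z_i$, where $\{Z_i\}$ are i.i.d. Bernoulli variables independent of $X$ with $P\{Z_i=1\}=c$; if $X$ has PGF $P(s)$ then $c\otimes X$ has PGF $P(1-c+cs)$. An $I_0$-valued process $\{X(t),t\ge0\}$ is $(a,H)$-semi-selfsimilar (SSS), with $0<a<1$ and $H>0$, if $\{X(at)\}\overset{d}{=}\{a^H\otimes X(t)\}$ (the thinning applied to $X(t)$ with a Bernoulli sequence independent of the process). An $I_0$-valued random variable with PGF $P(s)$ is discrete semi-stable$(a,b)$ if $P(s)\neq 0$ and $\{P(s)\}^a=P(1-b+bs)$ for all $0\le s\le 1$, where $0<b<1$ and $b=a^{1/\alpha}$ for some $\alpha\in(0,1]$. Semi-stability and semi-selfsimilarity are meant in the strict sense. *)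

(* Defs.v *)
From HB Require Import structures.
From mathcomp Require Import all_boot all_order all_algebra.
From mathcomp Require Import all_classical all_reals all_analysis.
Set Implicit Arguments. Unset Strict Implicit. Unset Printing Implicit Defensive.
Import Order.TTheory GRing.Theory Num.Theory.
Import numFieldNormedType.Exports.
Local Open Scope classical_set_scope.
Local Open Scope ring_scope.

Section Defs.
Context {R : realType} {d : measure_display} {T : measurableType d}.

(* Lévy process with values in I_0 = nat: X(0) = 0 (a.s.), stationary and
   independent increments, continuity in probability. Events are point
   events, which suffices for discrete (nat / int valued) variables. *)
Record levy_nat (P : probability T R) (X : R -> T -> nat) : Prop := {
  levy_meas : forall t k, measurable [set w | X t w = k];
  levy_0 : P [set w | X 0 w = 0%N] = 1%E;
  levy_stat : forall (s t : R) (k : int), 0 <= s -> s <= t ->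
    P [set w | (X t w)%:Z - (X s w)%:Z = k] = P [set w | (X (t - s) w)%:Z = k];
  levy_indep : forall (n : nat) (t : nat -> R) (k : nat -> int),
    0 <= t 0%N -> (forall i, t i <= t i.+1) ->
    P [set w | forall i, (i < n)%N -> (X (t i.+1) w)%:Z - (X (t i) w)%:Z = k i]
    = \big[*%E/1%E]_(i < n) P [set w | ((X (t i.+1) w)%:Z - (X (t i) w)%:Z)%R = k i];
  levy_cont : forall t, 0 <= t -> forall e : R, 0 < e -> exists2 del : R, 0 < del &
    forall s, 0 <= s -> `|s - t| < del -> (P [set w | X s w <> X t w] < e%:E)%E
}.

End Defs.

Definition fdd_eq {R : realType} {d d' : measure_display}
  {T : measurableType d} {T' : measurableType d'}
  (P : probability T R) (X : R -> T -> nat)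
  (Q : probability T' R) (Y : R -> T' -> nat) : Prop :=
  forall (n : nat) (t : nat -> R) (k : nat -> nat), (forall i, 0 <= t i) ->
    P [set w | forall i, (i < n)%N -> X (t i) w = k i]
    = Q [set w | forall i, (i < n)%N -> Y (t i) w = k i].

Definition bern_indep {R : realType} {d : measure_display} {T : measurableType d}
  (Q : probability T R) (c : R) (X : R -> T -> nat) (Z : nat -> T -> bool) : Prop :=
  forall (n : nat) (t : nat -> R) (k : nat -> nat) (m : nat) (b : nat -> bool),
    (forall i, 0 <= t i) ->
    Q [set w | (forall j, (j < n)%N -> X (t j) w = k j) /\
               (forall i, (i < m)%N -> Z i w = b i)]
    = (Q [set w | forall j, (j < n)%N -> X (t j) w = k j]
       * (\prod_(i < m) (if b i then c else 1 - c))%:E)%E.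

Definition thin_proc {T : Type} {R : Type} (X : R -> T -> nat) (Z : nat -> T -> bool)
  : R -> T -> nat :=
  fun t w => (\sum_(i < X t w) (Z i w : nat))%N.

(* (a,H)-semi-selfsimilarity: {X(a t)} =d {a^H (x) X(t)}, where the thinning
   uses a Bernoulli(a^H) sequence independent of the process. Since X and the
   Bernoulli sequence need not live on the same space, the right-hand side is
   realised on any probability space carrying a copy X' of X (same f.d.d.)
   together with such an independent Bernoulli sequence. *)
Definition sss {R : realType} {d : measure_display} {T : measurableType d}
  (P : probability T R) (X : R -> T -> nat) (a H : R) : Prop :=
  forall (d' : measure_display) (T' : measurableType d') (Q : probability T' R)
         (X' : R -> T' -> nat) (Z : nat -> T' -> bool),
    (forall t k, measurable [set w | X' t w = k]) ->
    (forall i, measurable [set w | Z i w]) ->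
    fdd_eq P X Q X' ->
    bern_indep Q (a `^ H) X' Z ->
    fdd_eq P (fun t => X (a * t)) Q (thin_proc X' Z).

Definition pgf {R : realType} (p : nat -> R) (s : R) : R :=
  limn (series (fun k => p k * s ^+ k)).

Definition semistable {R : realType} (p : nat -> R) (a b : R) : Prop :=
  forall s : R, 0 <= s <= 1 -> pgf p s != 0 /\ (pgf p s) `^ a = pgf p (1 - b + b * s).

Definition law {R : realType} {d : measure_display} {T : measurableType d}
  (P : probability T R) (Y : T -> nat) : nat -> R :=
  fun k => fine (P [set w | Y w = k]).

(* Main.v *)
(* Write phi_t for the PGF of X(t). Stationary independent increments make
   t |-> phi_t(s) multiplicative, continuity in probability at 0 makes it positive,
   and being at most 1 it is monotone; hence phi_t = phi_1 ^ t. Binomial thinning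
   replaces phi_t(s) by phi_t(1 - b + b s), and the thinned process again has
   stationary independent increments, because successive increments of X consume
   disjoint blocks of the Bernoulli sequence. So both processes are determined by
   their one-dimensional laws, and semi-selfsimilarity reduces to
   phi_1(s) ^ a = phi_a(s) = phi_1(1 - b + b s), by injectivity of PGFs. Since
   semi-selfsimilarity quantifies over realisations of the thinning, the forward
   direction needs one: X on a product space, with Bernoulli digits of a uniform
   variable. *)
Require Import Defs.
From HB Require Import structures.
From mathcomp Require Import all_boot all_order all_algebra.
From mathcomp Require Import all_classical all_reals all_analysis.
From mathcomp Require Import measurable_realfun ring lra.
Import Order.TTheory GRing.Theory Num.Theory.
Local Open Scope ring_scope.

Set Implicit Arguments.
Unset Strict Implicit.
Unset Printing Implicit Defensive.

(** * Generating functions of sub-probabilities on the naturals *)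

Section SubProbability.
Variable R : realType.
Implicit Types (p q : nat -> R) (s c t u : R).

(** Sub-probabilities rather than probabilities: the class is stable under deleting the coefficient
    of index 0, the move on which the induction in [pgf_inj] rests. *)
Definition subprob p : Prop :=
  (forall k, 0 <= p k) /\ (\sum_(k <oo) (p k)%:E <= 1)%E.

Lemma subprob_ge0 p k : subprob p -> 0 <= p k.
Proof. by case. Qed.

Lemma subprob_partial_sum p n : subprob p -> \sum_(0 <= k < n) p k <= 1.
Proof.
move=> [p0 p1]; rewrite -lee_fin -sumEFin; apply: le_trans p1.
by apply: nneseries_lim_ge => k _ _; rewrite lee_fin.
Qed.

Lemma subprob_le1 p k : subprob p -> p k <= 1.
Proof.
move=> hp; apply: le_trans (subprob_partial_sum k.+1 hp).
by rewrite big_nat_recr//= lerDr sumr_ge0// => i _; case: hp.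
Qed.

Lemma nneseries_recl_succ (f : nat -> \bar R) : (forall k, (0 <= f k)%E) ->
  (\sum_(k <oo) f k = f 0%N + \sum_(k <oo) f k.+1)%E.
Proof.
move=> f0; rewrite nneseries_recl// -nneseries_addn//; congr (_ + _)%E.
by apply: eq_eseriesr => k _; rewrite addn1.
Qed.

Lemma subprob_behead p : subprob p -> subprob (fun k => p k.+1).
Proof.
move=> [p0 p1]; split=> [k//|]; apply: le_trans p1.
by rewrite [leRHS]nneseries_recl_succ ?leeDr ?lee_fin// => k; rewrite lee_fin.
Qed.

(** The partial sums are nondecreasing and at most 1, so the real limit in [pgf] exists. In
    extended-real form sums of nonnegative terms can be exchanged freely. *)
Lemma pgfE p s : subprob p -> 0 <= s <= 1 ->
  (pgf p s)%:E = (\sum_(k <oo) (p k * s ^+ k)%:E)%E.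
Proof.
move=> hp /andP[s0 s1]; have p0 k := subprob_ge0 k hp.
have nd : {homo series (fun k => p k * s ^+ k) : n m / (n <= m)%N >-> n <= m}.
  apply/nondecreasing_seqP => n; rewrite /series/= big_nat_recr//= lerDl.
  by rewrite mulr_ge0// exprn_ge0.
rewrite /pgf -EFin_lim.
  by congr (limn _); apply/funext => n /=; rewrite sumEFin.
apply: nondecreasing_is_cvgn => //; exists 1 => _ [n _ <-].
apply: le_trans (subprob_partial_sum n hp); apply: ler_sum => k _.
by rewrite ler_piMr// exprn_ile1.
Qed.

Lemma pgf_ge_coef0 p s : subprob p -> 0 <= s <= 1 -> p 0%N <= pgf p s.
Proof.
move=> hp hs; rewrite -lee_fin pgfE//; case/andP: hs => s0 s1.
have := @nneseries_lim_ge R (fun k => (p k * s ^+ k)%:E) predT 0 1.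
rewrite big_nat1 expr0 mulr1; apply=> k _ _.
by rewrite lee_fin mulr_ge0 ?exprn_ge0 ?(subprob_ge0 _ hp).
Qed.

Lemma pgf_le1 p s : subprob p -> 0 <= s <= 1 -> pgf p s <= 1.
Proof.
move=> hp hs; rewrite -lee_fin pgfE//; case/andP: hs => s0 s1.
apply: le_trans hp.2; apply: lee_nneseries => k _.
  by rewrite lee_fin mulr_ge0 ?exprn_ge0 ?(subprob_ge0 _ hp).
by rewrite lee_fin ler_piMr ?exprn_ile1 ?(subprob_ge0 _ hp).
Qed.

Lemma pgf_behead p s : subprob p -> 0 <= s <= 1 ->
  pgf p s = p 0%N + s * pgf (fun k => p k.+1) s.
Proof.
move=> hp hs; apply: EFin_inj; rewrite EFinD EFinM !pgfE//; last exact: subprob_behead.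
case/andP: hs => s0 s1.
have t0 k : (0 <= (p k * s ^+ k)%:E)%E.
  by rewrite lee_fin mulr_ge0 ?exprn_ge0 ?(subprob_ge0 _ hp).
rewrite nneseries_recl_succ// expr0 mulr1; congr (_ + _)%E.
rewrite -nneseriesZl => [|k _]; last first.
  by rewrite lee_fin mulr_ge0 ?exprn_ge0 ?(subprob_ge0 _ hp).
by apply: eq_eseriesr => k _; rewrite exprS -EFinM; congr (_%:E); ring.
Qed.

(** Each function is its constant term plus s times a tail value in [0, 1], so the constant terms
    differ by at most s, which is arbitrarily small. *)
Lemma pgf_coef0_inj p q : subprob p -> subprob q ->
  (forall s, 0 < s <= 1 -> pgf p s = pgf q s) -> p 0%N = q 0%N.
Proof.
move=> hp hq pq.
apply/eqP; rewrite -subr_eq0 -normr_eq0; apply/eqP/le_anti; rewrite normr_ge0 andbT.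
apply/ler_addgt0Pl => e e0; rewrite addr0.
pose s := Num.min e 1.
have s01 : 0 < s <= 1 by rewrite lt_min e0 ltr01 ge_min lexx orbT.
have [s01' se] : 0 <= s <= 1 /\ s <= e.
  by rewrite (andP s01).2 ltW ?(andP s01).1//; split => //; rewrite ge_min lexx.
have := pq s s01; rewrite (pgf_behead hp s01') (pgf_behead hq s01').
have := pgf_le1 (subprob_behead hp) s01'; have := pgf_le1 (subprob_behead hq) s01'.
have := le_trans (subprob_ge0 1%N hp) (pgf_ge_coef0 (subprob_behead hp) s01').
have := le_trans (subprob_ge0 1%N hq) (pgf_ge_coef0 (subprob_behead hq) s01').
case/andP: s01'; set A := pgf _ s; set B := pgf _ s => s0 s1 B0 A0 B1 A1 E.
by rewrite ler_norml; apply/andP; split; nra.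
Qed.

(** Equal constant terms cancel, and division by s > 0 leaves the same hypothesis for the shifted
    sequences. *)
Lemma pgf_inj p q : subprob p -> subprob q ->
  (forall s, 0 < s <= 1 -> pgf p s = pgf q s) -> p =1 q.
Proof.
move=> hp hq pq n; elim: n p q hp hq pq => [|n IHn] p q hp hq pq.
  exact: pgf_coef0_inj.
apply: (IHn (fun k => p k.+1) (fun k => q k.+1)); [exact: subprob_behead..|].
move=> s s01; have /andP[s0 s1] := s01.
have s01' : 0 <= s <= 1 by rewrite ltW.
have := pq s s01; rewrite (pgf_behead hp s01') (pgf_behead hq s01').
rewrite (pgf_coef0_inj hp hq pq) => /addrI.
by apply: mulfI; rewrite gt_eqF.
Qed.

(** The law of i + N for N of law [p], read below as the transition probability from [i] to [k] of a
    walk with step law [p]. *)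
Definition delay p (i k : nat) : R := if (i <= k)%N then p (k - i)%N else 0.

Lemma nneseries_delay p (h : nat -> \bar R) i :
  (forall k, 0 <= p k) -> (forall k, (0 <= h k)%E) ->
  (\sum_(k <oo) (delay p i k)%:E * h k = \sum_(k <oo) (p k)%:E * h (i + k)%N)%E.
Proof.
move=> p0 h0.
have t0 k : (0 <= (delay p i k)%:E * h k)%E.
  by rewrite mule_ge0// lee_fin /delay; case: ifP.
rewrite (nneseries_split 0 i)// add0n big_nat big1 => [|k /andP[_ ki]].
  rewrite add0e -nneseries_addn//; apply: eq_eseriesr => k _.
  by rewrite /delay leq_addl addnK addnC.
by rewrite /delay leqNgt ki mul0e.
Qed.

(** The binomial(l, c) masses, encoded as coefficients of their generating polynomial, so that
    recursion and evaluation come from polynomial algebra. *)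
Definition thin_pmf c l k : R := (((1 - c)%:P + c *: 'X) ^+ l)`_k.

Lemma thin_pmf0 c k : thin_pmf c 0 k = (k == 0%N)%:R.
Proof. by rewrite /thin_pmf expr0 coef1. Qed.

Lemma thin_pmfS c l k :
  thin_pmf c l.+1 k = (1 - c) * thin_pmf c l k + c * delay (thin_pmf c l) 1 k.
Proof.
rewrite /thin_pmf exprS mulrDl coefD coefCM -scalerAl coefZ coefXM /delay.
by case: k => [|k]//=; rewrite subn1.
Qed.

Lemma thin_pmf_ge0 c l k : 0 <= c <= 1 -> 0 <= thin_pmf c l k.
Proof.
move=> /andP[c0 c1]; elim: l k => [|l IHl] k; first by rewrite thin_pmf0.
rewrite thin_pmfS addr_ge0// mulr_ge0// ?subr_ge0//.
by rewrite /delay; case: ifP.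
Qed.

Lemma thin_pmf_pgf c l s : 0 <= c <= 1 -> 0 <= s ->
  (\sum_(k <oo) (thin_pmf c l k * s ^+ k)%:E)%E = ((1 - c + c * s) ^+ l)%:E.
Proof.
move=> c01 s0; set p := ((1 - c)%:P + c *: 'X) ^+ l.
rewrite (nneseries_split 0 (size p)) => [|k _]; last first.
  by rewrite lee_fin mulr_ge0 ?exprn_ge0 ?thin_pmf_ge0.
rewrite add0n [X in (_ + X)%E]eseries0 => [|k pk _]; last first.
  by rewrite /thin_pmf -/p nth_default// mul0r.
rewrite adde0 sumEFin big_mkord -horner_coef /p horner_exp.
by rewrite hornerD hornerC hornerZ hornerX.
Qed.

Lemma thin_pmf_subprob c l : 0 <= c <= 1 -> subprob (thin_pmf c l).
Proof.
move=> c01; split=> [k|]; first exact: thin_pmf_ge0.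
have := thin_pmf_pgf l c01 ler01; rewrite mulr1 subrK expr1n => <-.
by apply: lee_nneseries => k _; rewrite ?lee_fin ?thin_pmf_ge0// expr1n mulr1.
Qed.

(** The law of the thinning of N for N of law [p]: a mixture of binomials over the value l of N. For
    a sub-probability the sum is at most 1, so [fine] loses nothing. *)
Definition thin_law c p k : R := fine (\sum_(l <oo) (p l * thin_pmf c l k)%:E)%E.

Lemma thin_lawE c p k : 0 <= c <= 1 -> subprob p ->
  (thin_law c p k)%:E = (\sum_(l <oo) (p l * thin_pmf c l k)%:E)%E.
Proof.
move=> c01 hp; have t0 l : 0 <= p l * thin_pmf c l k.
  by rewrite mulr_ge0 ?thin_pmf_ge0 ?(subprob_ge0 _ hp).
rewrite /thin_law fineK// ge0_fin_numE; last first.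
  by apply: nneseries_ge0 => l _ _; rewrite lee_fin.
apply: (@le_lt_trans _ _ 1%E); last exact: ltry.
apply: le_trans hp.2; apply: lee_nneseries => l _; rewrite lee_fin//.
by rewrite ler_piMr ?(subprob_ge0 _ hp) ?(subprob_le1 _ (thin_pmf_subprob _ _)).
Qed.

Lemma thin_law_ge0 c p k : 0 <= c <= 1 -> subprob p -> 0 <= thin_law c p k.
Proof.
move=> c01 hp; rewrite -lee_fin thin_lawE//; apply: nneseries_ge0 => l _ _.
by rewrite lee_fin mulr_ge0 ?thin_pmf_ge0 ?(subprob_ge0 _ hp).
Qed.

(** By Tonelli the sum over k may be taken first, and it is the binomial generating function. *)
Lemma thin_law_series c p s : 0 <= c <= 1 -> subprob p -> 0 <= s ->
  (\sum_(k <oo) (thin_law c p k * s ^+ k)%:E =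
   \sum_(l <oo) (p l * (1 - c + c * s) ^+ l)%:E)%E.
Proof.
move=> c01 hp s0.
transitivity (\sum_(k <oo) \sum_(l <oo) (p l * thin_pmf c l k * s ^+ k)%:E)%E.
  apply: eq_eseriesr => k _; rewrite EFinM thin_lawE// muleC -nneseriesZl.
    by apply: eq_eseriesr => l _; rewrite -EFinM mulrC.
  by move=> l _; rewrite lee_fin mulr_ge0 ?thin_pmf_ge0 ?(subprob_ge0 _ hp).
rewrite nneseries_interchange => [|k l]; last first.
  by rewrite lee_fin !mulr_ge0 ?exprn_ge0 ?thin_pmf_ge0 ?(subprob_ge0 _ hp).
apply: eq_eseriesr => l _; rewrite EFinM -thin_pmf_pgf// -nneseriesZl.
  by apply: eq_eseriesr => k _; rewrite -EFinM mulrA.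
by move=> k _; rewrite lee_fin mulr_ge0 ?exprn_ge0 ?thin_pmf_ge0.
Qed.

Lemma thin_law_subprob c p : 0 <= c <= 1 -> subprob p -> subprob (thin_law c p).
Proof.
move=> c01 hp; split=> [k|]; first exact: thin_law_ge0.
apply: le_trans hp.2; rewrite le_eqVlt; apply/orP; left; apply/eqP.
have := thin_law_series c01 hp ler01; rewrite mulr1 subrK.
under eq_eseriesr do rewrite expr1n mulr1.
by move=> ->; apply: eq_eseriesr => k _; rewrite expr1n mulr1.
Qed.

Lemma pgf_thin_law c p s : 0 <= c <= 1 -> subprob p -> 0 <= s <= 1 ->
  pgf (thin_law c p) s = pgf p (1 - c + c * s).
Proof.
move=> c01 hp s01; apply: EFin_inj; rewrite !pgfE//; last exact: thin_law_subprob.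
  by case/andP: s01 => s0 s1; exact: thin_law_series.
by case/andP: s01 => s0 s1; case/andP: c01 => c0 c1; nra.
Qed.

(** The last hypothesis makes r the convolution of p and q; after exchanging the sums, the delay by
    i contributes the factor s ^ i. *)
Lemma pgf_conv p q r s : subprob p -> subprob q -> subprob r -> 0 <= s <= 1 ->
  (forall k, (r k)%:E = (\sum_(i <oo) (p i * delay q i k)%:E)%E) ->
  pgf r s = pgf p s * pgf q s.
Proof.
move=> hp hq hr s01 rE; have /andP[s0 s1] := s01.
have delay0 i k : 0 <= delay q i k.
  by rewrite /delay; case: ifP => // _; exact: subprob_ge0.
apply: EFin_inj; rewrite EFinM !pgfE//.
transitivity (\sum_(k <oo) \sum_(i <oo) (p i * delay q i k * s ^+ k)%:E)%E.
  apply: eq_eseriesr => k _; rewrite EFinM rE muleC -nneseriesZl.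
    by apply: eq_eseriesr => l _; rewrite -EFinM mulrC.
  by move=> l _; rewrite lee_fin mulr_ge0 ?(subprob_ge0 _ hp).
rewrite nneseries_interchange => [|k l]; last first.
  by rewrite lee_fin !mulr_ge0 ?exprn_ge0 ?(subprob_ge0 _ hp).
rewrite -(pgfE hq s01) [RHS]muleC -nneseriesZl; last first.
  by move=> i _; rewrite lee_fin mulr_ge0 ?exprn_ge0 ?(subprob_ge0 _ hp).
apply: eq_eseriesr => i _.
transitivity ((p i)%:E * \sum_(k <oo) ((delay q i k)%:E * (s ^+ k)%:E))%E.
  rewrite -[in RHS]nneseriesZl => [|k _]; last by rewrite -EFinM lee_fin mulr_ge0 ?exprn_ge0.
  by apply: eq_eseriesr => k _; rewrite -!EFinM mulrA.
rewrite nneseries_delay => [|k|k]; [|exact: subprob_ge0|by rewrite lee_fin exprn_ge0].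
rewrite EFinM muleCA; congr (_ * _)%E; rewrite pgfE// muleC -nneseriesZl => [|k _].
  by apply: eq_eseriesr => k _; rewrite exprD -!EFinM; congr (_%:E); ring.
by rewrite lee_fin mulr_ge0 ?exprn_ge0 ?(subprob_ge0 _ hq).
Qed.

(** Cauchy's equation with nonnegativity in place of continuity: L is monotone, and squeezing L (n
    t) between L m and L (m + 1), m being the integer part of n t, gives n |L t - t L 1| <= L 1 for
    every n. *)
Lemma additive_ge0_linear (L : R -> R) : (forall t, 0 <= t -> 0 <= L t) ->
  (forall t u, 0 <= t -> 0 <= u -> L (t + u) = L t + L u) ->
  forall t, 0 <= t -> L t = t * L 1.
Proof.
move=> L0 LD.
have LM t n : 0 <= t -> L (n%:R * t) = n%:R * L t.
  move=> t0; elim: n => [|n IHn].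
    by rewrite !mul0r; have := LD 0 0 (lexx _) (lexx _); rewrite addr0; lra.
  by rewrite -addn1 natrD !mulrDl !mul1r LD ?mulr_ge0// IHn.
have Ln n : L n%:R = n%:R * L 1 by rewrite -[n%:R]mulr1 LM// mulr1.
have Lle t u : 0 <= t <= u -> L t <= L u.
  by move=> /andP[t0 tu]; rewrite -[u](subrK t) LD ?subr_ge0// lerDr L0// subr_ge0.
move=> t t0.
have close n : n%:R * `|L t - t * L 1| <= L 1.
  have nt0 : 0 <= n%:R * t by rewrite mulr_ge0.
  have /andP[m1 m2] := truncn_itv nt0; set m := Num.truncn (n%:R * t) in m1 m2.
  rewrite -[X in X * _]ger0_norm// -normrM ler_norml.
  have mle : (m%:R : R) <= n%:R * t by [].
  have mlt : n%:R * t <= m.+1%:R by exact: ltW.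
  have := Lle m%:R (n%:R * t); rewrite ler0n mle LM// Ln => /(_ isT) H1.
  have := Lle (n%:R * t) m.+1%:R; rewrite nt0 mlt LM// Ln => /(_ isT) H2.
  have L10 := L0 1 ler01.
  rewrite -[m.+1]addn1 natrD in mlt H2.
  by apply/andP; split; nra.
apply/eqP; rewrite -subr_eq0 -normr_eq0; apply/eqP/le_anti; rewrite normr_ge0 andbT.
rewrite leNgt; apply/negP => d0.
(* An n exceeding L 1 / |L t - t L 1| contradicts the bound. *)
have := close (Num.truncn (L 1 / `|L t - t * L 1|)).+1; apply/negP; rewrite -ltNge.
rewrite -ltr_pdivrMr//.
have /truncn_itv/andP[]// : 0 <= L 1 / `|L t - t * L 1| by rewrite divr_ge0 ?L0.
Qed.

(** The function -ln f is additive, and nonnegative because f <= 1, hence linear. *)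
Lemma multiplicative_powR (f : R -> R) :
  (forall t, 0 <= t -> 0 < f t <= 1) ->
  (forall t u, 0 <= t -> 0 <= u -> f (t + u) = f t * f u) ->
  forall t, 0 <= t -> f t = f 1 `^ t.
Proof.
move=> f01 fM t t0.
have f0 u : 0 <= u -> 0 < f u by move=> /f01/andP[].
have := @additive_ge0_linear (fun u => - ln (f u)).
move=> /(_ _ _ t t0) H.
rewrite /powR gt_eqF ?f0// -[LHS]lnK ?posrE ?f0//; congr expR.
rewrite -[LHS]opprK H ?mulrN ?opprK//.
  by move=> u u0; rewrite oppr_ge0 ln_le0// (andP (f01 u u0)).2.
by move=> u v u0 v0; rewrite fM// lnM ?posrE ?f0// opprD.
Qed.

End SubProbability.

(** * Sums of Bernoulli variables over consecutive blocks *)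

Section FiniteConjunctions.
Local Open Scope classical_set_scope.

Lemma measurable_forall_lt {d : measure_display} {T : measurableType d}
    (A : nat -> set T) n : (forall i, measurable (A i)) ->
  measurable [set w | forall i, (i < n)%N -> A i w].
Proof.
move=> mA; rewrite (_ : [set _ | _] = \bigcap_(i in [set i | (i < n)%N]) A i).
  by apply: bigcap_measurableType => i _; exact: mA.
by apply/seteqP; split => w /= h i; exact: h.
Qed.

End FiniteConjunctions.

Section Thinning.
Local Open Scope classical_set_scope.
Context {R : realType} {d : measure_display} {T : measurableType d}.
Variables (Q : probability T R) (c : R) (Z : nat -> T -> bool).
Hypotheses (c01 : 0 <= c <= 1) (mZ : forall i, measurable [set w | Z i w]).

Let bern (v : bool) : R := if v then c else 1 - c.

Let measurable_Z i v : measurable [set w | Z i w = v].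
Proof.
case: v; first exact: mZ.
rewrite (_ : [set _ | _] = ~` [set w | Z i w]); first exact/measurableC/mZ.
by apply/seteqP; split => w /=; case: (Z i w).
Qed.

(** The invariant carried along while bits are consumed: relative to E, the bits from index m on are
    still fresh Bernoulli(c) variables, tested on finite cylinders. *)
Definition indep_from (m : nat) (E : set T) : Prop :=
  measurable E /\ forall l (b : nat -> bool),
    Q [set w | E w /\ forall i, (i < l)%N -> Z (m + i)%N w = b i] =
    (Q E * (\prod_(i < l) (if b i then c else 1 - c))%:E)%E.

Lemma indep_from_bit m E v : indep_from m E ->
  indep_from m.+1 (E `&` [set w | Z m w = v]) /\
  Q (E `&` [set w | Z m w = v]) = (Q E * (bern v)%:E)%E.
Proof.
move=> [mE hE].
have QE : Q (E `&` [set w | Z m w = v]) = (Q E * (bern v)%:E)%E.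
  have := hE 1%N (fun=> v); rewrite big_ord1 => <-; congr (Q _).
  apply/seteqP; split => w [Ew] /= h; split => //; last by rewrite -(h 0%N)// addn0.
  by move=> [|]//; rewrite addn0.
split=> //; split=> [|l b]; first exact/measurableI/measurable_Z.
rewrite QE -muleA -EFinM -[bern v * _]/(_ * _).
(* The pattern puts v at bit m and lets b govern the later bits. *)
have := hE l.+1 (fun i => if i is j.+1 then b j else v).
rewrite big_ord_recl/= => <-; congr (Q _).
apply/seteqP; split => w /=.
  by move=> [[Ew Zv] h]; split => // -[|i]; rewrite ?addn0// addnS -addSn ltnS => /h.
move=> [Ew h]; split; first by split => //; rewrite -(h 0%N)// addn0.
by move=> i il; rewrite -(h i.+1)// addnS addSn.
Qed.

Lemma indep_fromU m E F : indep_from m E -> indep_from m F -> E `&` F = set0 ->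
  indep_from m (E `|` F).
Proof.
move=> [mE hE] [mF hF] EF0; split=> [|l b]; first exact: measurableU.
have mb : measurable [set w | forall i, (i < l)%N -> Z (m + i)%N w = b i].
  by apply: measurable_forall_lt => i; exact: measurable_Z.
rewrite measureU// ge0_muleDl// -hE -hF -measureU; [|exact: measurableI..|].
  congr (Q _); apply/seteqP; split => w /=; first by case=> -[]; tauto.
  by case=> -[]; tauto.
by rewrite setIACA EF0 set0I.
Qed.

Lemma indep_from0 m : indep_from m set0.
Proof.
split=> // l b; rewrite measure0 mul0e (_ : [set _ | _] = set0) ?measure0//.
by apply/seteqP; split => w // -[].
Qed.

(** Induction on l by the last bit: k + 1 successes arise from k + 1 and a failure or, disjointly,
    from k and a success, which is the recursion [thin_pmfS]. *)
Lemma indep_from_incr m E l k : indep_from m E ->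
  let F := E `&` [set w | (\sum_(i < l) Z (m + i) w)%N = k] in
  indep_from (m + l) F /\ Q F = (Q E * (thin_pmf c l k)%:E)%E.
Proof.
move=> hE /=; elim: l k => [|l IHl] k.
  rewrite addn0 thin_pmf0; case: (altP (k =P 0%N)) => [->|k0].
    rewrite (_ : [set _ | _] = setT) ?setIT ?mule1//.
    by apply/seteqP; split => w //= _; rewrite big_ord0.
  rewrite (_ : [set _ | _] = set0) ?setI0.
    by split; [exact: indep_from0 | rewrite measure0 mule0].
  by apply/seteqP; split => w //=; rewrite big_ord0 => k0'; move: k0; rewrite -k0'.
have [h0 Q0] := IHl k; have [h0' Q0'] := indep_from_bit false h0.
rewrite addnS thin_pmfS /delay.
(* For a successor, the instance at [k.-1] is the count one lower, required when the last bit is a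
   success. *)
case: k {IHl} (IHl k.-1) h0 Q0 h0' Q0' => [|k] /= [h1 Q1] h0 Q0 h0' Q0'.
  set F := E `&` _; suff -> : F = E `&` [set w | (\sum_(i < l) Z (m + i) w)%N = 0%N] `&`
      [set w | Z (m + l) w = false].
    by rewrite Q0' Q0 mulr0 addr0 -muleA -EFinM mulrC.
  apply/seteqP; rewrite /F -setIA; split => w [Ew]; rewrite /setI/= big_ord_recr/=.
    by case: (Z (m + l) w); rewrite ?addn1// addn0.
  by move=> [-> ->].
have [h1' Q1'] := indep_from_bit true h1.
set F := E `&` _; pose A := E `&` [set w | (\sum_(i < l) Z (m + i) w)%N = k.+1] `&`
      [set w | Z (m + l) w = false].
pose B := E `&` [set w | (\sum_(i < l) Z (m + i) w)%N = k] `&`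
      [set w | Z (m + l) w = true].
have FE : F = A `|` B.
  apply/seteqP; rewrite /F /A /B; split => w /=; rewrite big_ord_recr/=.
    move=> [Ew]; case: (Z (m + l) w); rewrite ?addn1 ?addn0; last by left.
    by move=> [?]; right.
  by move=> [[[Ew] + ->]|[[Ew] + ->]] => ->; rewrite ?addn0 ?addn1.
have AB0 : A `&` B = set0.
  by apply/seteqP; rewrite /A /B; split => w //= [[_ ->] [_]].
rewrite FE; split; first exact: indep_fromU.
have -> : Q (A `|` B) = (Q A + Q B)%E by rewrite measureU//; [exact: h0'.1|exact: h1'.1].
rewrite Q0' Q1' Q0 Q1 -!muleA -!EFinM -ge0_muleDr.
- by rewrite /= subn1 -EFinD; congr (_ * _%:E)%E; rewrite /bern; ring.
- by rewrite lee_fin mulr_ge0 ?thin_pmf_ge0// subr_ge0; case/andP: c01.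
- by rewrite lee_fin mulr_ge0 ?thin_pmf_ge0//; case/andP: c01.
Qed.

(** Index 0 gets predecessor 0, the starting value of the processes. *)
Definition prev_val (f : nat -> nat) (i : nat) : nat := if i is j.+1 then f j else 0%N.

(** As x is nondecreasing, each sum extends the previous one by a block of bits not yet read, so the
    increments are independent binomials. *)
Lemma indep_from_partial_sums E n (x k : nat -> nat) : indep_from 0 E ->
  (forall i, (i < n)%N -> (prev_val x i <= x i)%N) ->
  let F := [set w | E w /\ forall i, (i < n)%N -> (\sum_(j < x i) Z j w)%N = k i] in
  indep_from (prev_val x n) F /\
  Q F = (Q E * (\prod_(i < n)
    delay (thin_pmf c (x i - prev_val x i)) (prev_val k i) (k i))%:E)%E.
Proof.
move=> hE /=; elim: n => [|n IHn] hx.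
  rewrite big_ord0 mule1 (_ : [set _ | _] = E)//.
  by apply/seteqP; split => w // [].
have {IHn}[|] := IHn; first by move=> i /ltnW; exact: hx.
set F := [set _ | _] => hF QF; set G := [set _ | _].
have xn := hx n (leqnn _).
(* The sum splits into the previous one, whose value is fixed on F, and a fresh block. *)
have SE w : F w -> (\sum_(j < x n) Z j w =
    prev_val k n + \sum_(j < x n - prev_val x n) Z (prev_val x n + j) w)%N.
  move=> Fw; move: (x n - prev_val x n)%N (subnKC xn) => e <-.
  rewrite big_split_ord/=; congr (_ + _)%N.
  by case: Fw => _; case: (n) => [|m] h; [rewrite big_ord0|exact: h].
have GE : G = F `&` [set w | (\sum_(j < x n) Z j w)%N = k n].
  apply/seteqP; split => w /=.
    by move=> [Ew h]; split; [split => // i /ltnW; exact: h|exact: h].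
  move=> [[Ew h] hn]; split => // i; rewrite ltnS leq_eqVlt => /predU1P[->//|]; exact: h.
(* A target below the previous one is impossible, since the sums are nondecreasing: the event is
   empty and the factor is 0. *)
rewrite big_ord_recr/= {2}/delay; case: ifP => kn; last first.
  suff -> : G = set0 by split; [exact: indep_from0|rewrite measure0 mulr0 mule0].
  apply/seteqP; split => // w; rewrite GE => -[Fw]/=; rewrite SE// => h.
  by move: kn; rewrite -h leq_addr.
have [h1 Q1] := indep_from_incr (x n - prev_val x n) (k n - prev_val k n) hF.
rewrite subnKC// in h1.
suff -> : G = F `&`
    [set w | (\sum_(i < x n - prev_val x n) Z (prev_val x n + i) w)%N = (k n - prev_val k n)%N].
  by split => //; rewrite Q1 QF EFinM muleA.
rewrite GE; apply/seteqP; split => w /= [Fw]; rewrite SE// => h; split => //.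
  by rewrite -h addKn.
by rewrite h subnKC.
Qed.

Lemma measure_partition (N : T -> nat) (E : set T) :
  (forall k, measurable [set w | N w = k]) -> measurable E ->
  Q E = (\sum_(k <oo) Q (E `&` [set w | N w = k]))%E.
Proof.
move=> mN mE; rewrite -measure_semi_bigcup.
- congr (Q _); rewrite -setI_bigcupr (_ : \bigcup_n _ = setT) ?setIT//.
  by apply/seteqP; split => w // _; exists (N w).
- by move=> k; exact: measurableI.
- by apply/trivIsetP => i j _ _ ij; apply/seteqP; split => w //= -[[_ ->] [_ /eqP]]; exact/negP.
- by apply: bigcup_measurable => k _; exact: measurableI.
Qed.

(** * Joint law of the thinned values of a walk *)

Section Fdd.
Variables (n : nat) (N : nat -> T -> nat) (p : nat -> nat -> R).
Hypotheses (mN : forall i k, measurable [set w | N i w = k])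
  (hp : forall i, subprob (p i))
  (NE : forall x : nat -> nat, Q [set w | forall i, (i < n)%N -> N i w = x i] =
     (\prod_(i < n) delay (p i) (prev_val x i) (x i))%:E)
  (indepN : forall x : nat -> nat,
     indep_from 0 [set w | forall i, (i < n)%N -> N i w = x i]).

Lemma measurable_partial_sum l k : measurable [set w | (\sum_(j < l) Z j w)%N = k].
Proof.
elim: l k => [|l IHl] k.
  case: (eqVneq k 0%N) => [->|/eqP k0].
    rewrite (_ : [set _ | _] = setT)//.
    by apply/seteqP; split => w //= _; rewrite big_ord0.
  rewrite (_ : [set _ | _] = set0)//.
  by apply/seteqP; split => w //=; rewrite big_ord0 => /esym.
rewrite (_ : [set _ | _] =
  ([set w | (\sum_(j < l) Z j w)%N = k] `&` [set w | Z l w = false]) `|`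
  \bigcup_(k' in [set k' | k'.+1 = k])
    ([set w | (\sum_(j < l) Z j w)%N = k'] `&` [set w | Z l w = true])).
  apply: measurableU; first exact/measurableI/measurable_Z.
  by apply: bigcup_measurable => k' _; exact/measurableI/measurable_Z.
apply/seteqP; split => w /=; rewrite big_ord_recr/=.
  by case Zl: (Z l w); rewrite ?addn0 ?addn1 => hk;
    [right; exists (\sum_(j < l) Z j w)%N|left].
by move=> [[<- ->]|[k' <- [<- ->]]]; rewrite ?addn0 ?addn1.
Qed.

Lemma measurable_random_sum (M : T -> nat) k :
  (forall l, measurable [set w | M w = l]) ->
  measurable [set w | (\sum_(j < M w) Z j w)%N = k].
Proof.
move=> mM; rewrite (_ : [set _ | _] = \bigcup_l
    ([set w | M w = l] `&` [set w | (\sum_(j < l) Z j w)%N = k])).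
  by apply: bigcup_measurable => l _; exact/measurableI/measurable_partial_sum.
by apply/seteqP; split => w /=; [exists (M w) | move=> [l _ [-> ->]]].
Qed.

(** Sums out the value y of the walk after l. Only y - l matters, so the result no longer depends on
    l; this is what lets the summation proceed from the last index backwards. *)
Lemma thin_step i k' k l :
  (\sum_(y <oo) (delay (p i) l y * delay (thin_pmf c (y - l)) k' k)%:E)%E =
  (delay (thin_law c (p i)) k' k)%:E.
Proof.
under eq_eseriesr do rewrite EFinM.
rewrite nneseries_delay => [|y|y]; [|exact: subprob_ge0|]; last first.
  by rewrite lee_fin /delay; case: ifP => // _; exact: thin_pmf_ge0.
under eq_eseriesr do rewrite addKn -EFinM.
rewrite /delay; case: ifP => _; first by rewrite thin_lawE.
by apply: eseries0 => y _ _; rewrite mulr0.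
Qed.

(* Downward induction on m: each step sums out the value of N m. *)
Lemma thin_fdd_prefix m (x k : nat -> nat) : (m <= n)%N ->
  Q [set w | (forall i, (i < m)%N -> N i w = x i) /\
             forall i, (i < n)%N -> (\sum_(j < N i w) Z j w)%N = k i] =
  ((\prod_(i < m) (delay (p i) (prev_val x i) (x i) *
                   delay (thin_pmf c (x i - prev_val x i)) (prev_val k i) (k i))) *
   \prod_(m <= i < n) delay (thin_law c (p i)) (prev_val k i) (k i))%:E.
Proof.
move=> mn; rewrite -(subKn mn); move: (n - m)%N (leq_subr m n) => {m mn} l.
elim: l x => [|l IHl] x ln.
  rewrite subn0 big_geq// mulr1 big_split/= EFinM -NE.
  (* If x decreases somewhere, a [delay] factor vanishes and both sides are 0. *)
  have [hx|] := pselect (forall i, (i < n)%N -> (prev_val x i <= x i)%N).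
    rewrite -(indep_from_partial_sums k (indepN x) hx).2; congr (Q _).
    by apply/seteqP; split => w /= [h1 h2]; split => // i hi; move: (h2 i hi); rewrite h1.
  move=> /existsNP[i /not_implyP[hi /negP hxi]].
  have A0 : Q [set w | forall i, (i < n)%N -> N i w = x i] = 0%E.
    by rewrite NE (bigD1 (Ordinal hi))//= {1}/delay (negbTE hxi) mul0r.
  rewrite A0 mul0e; apply: subset_measure0 A0 => //.
  - rewrite (_ : [set _ | _] = [set w | forall i, (i < n)%N -> N i w = x i] `&`
      [set w | forall i, (i < n)%N -> (\sum_(j < N i w) Z j w)%N = k i])//.
    apply: measurableI; apply: measurable_forall_lt => j; first exact: mN.
    by apply: measurable_random_sum => z; exact: mN.
  - by apply: measurable_forall_lt => j; exact: mN.
  - by move=> w [].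
have lm : (n - l = (n - l.+1).+1)%N by rewrite subnSK.
set m := (n - l.+1)%N in lm *.
have mn : (m < n)%N by rewrite -lm leq_subr.
rewrite (measure_partition (mN m)); last first.
  rewrite (_ : [set _ | _] = [set w | forall i, (i < m)%N -> N i w = x i] `&`
      [set w | forall i, (i < n)%N -> (\sum_(j < N i w) Z j w)%N = k i])//.
  apply: measurableI; apply: measurable_forall_lt => j; first exact: mN.
  by apply: measurable_random_sum => z; exact: mN.
set A := \prod_(i < m) _.
set B := \prod_(m.+1 <= i < n) delay (thin_law c (p i)) (prev_val k i) (k i).
rewrite big_ltn// -/B mulrCA mulrC EFinM.
transitivity (\sum_(y <oo) ((A * B)%:E * (delay (p m) (prev_val x m) y *
    delay (thin_pmf c (y - prev_val x m)) (prev_val k m) (k m))%:E))%E.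
  apply: eq_eseriesr => y _.
  (* Overwriting x at m by y allows the induction hypothesis at m + 1 and leaves the factors below m
     unchanged. *)
  pose x' i := if i == m then y else x i.
  have x'E i : (i < m)%N -> x' i = x i by rewrite /x' => /ltn_eqF ->.
  have px'E i : (i <= m)%N -> prev_val x' i = prev_val x i by case: i => //= i /x'E.
  have := IHl x' (ltnW ln); rewrite lm big_ord_recr/= -/B px'E// /x' eqxx -/x'.
  rewrite (eq_bigr (fun i : 'I_m => delay (p i) (prev_val x i) (x i) *
                   delay (thin_pmf c (x i - prev_val x i)) (prev_val k i) (k i))); last first.
    by move=> i _; rewrite /= -/(x' i) x'E ?px'E// ltnW.
  rewrite -/A => Hy; rewrite -EFinM mulrAC -Hy.
  congr (Q _); apply/seteqP; split => w /=.
    move=> [[h1 h2] h3]; split => // i; rewrite ltnS leq_eqVlt => /predU1P[->|im].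
      by rewrite eqxx.
    by rewrite (ltn_eqF im) h1.
  move=> [h1 h2]; split; last by rewrite h1// eqxx.
  by split => // i im; rewrite h1 ?(ltn_eqF im)// ltnW.
rewrite nneseriesZl => [|y _]; first by rewrite thin_step.
rewrite lee_fin mulr_ge0// /delay; case: ifP => // _; first exact: subprob_ge0.
exact: thin_pmf_ge0.
Qed.

Lemma thin_fdd k :
  Q [set w | forall i, (i < n)%N -> (\sum_(j < N i w) Z j w)%N = k i] =
  (\prod_(i < n) delay (thin_law c (p i)) (prev_val k i) (k i))%:E.
Proof.
(* With an empty prefix the values x are arbitrary; k serves. *)
have := thin_fdd_prefix k k (leq0n n); rewrite big_ord0 mul1r big_mkord => <-.
by congr (Q _); apply/seteqP; split => w /= => [h|[]//]; split.
Qed.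

End Fdd.

End Thinning.

(** * One-dimensional laws determine a Levy process and its thinning *)

Section RandomNaturals.
Local Open Scope classical_set_scope.
Context {R : realType} {d : measure_display} {T : measurableType d}.
Variable P : probability T R.

Lemma probability_setI1 (E G : set T) : measurable E -> measurable G ->
  P G = 1%E -> P (E `&` G) = P E.
Proof.
move=> mE mG G1.
have PC0 : P (~` G) = 0%E by rewrite probability_setC// G1 subee.
have mEG : measurable (E `&` G) by exact: measurableI.
have mEC : measurable (E `\` G) by exact: measurableD.
have -> : P E = (P (E `&` G) + P (E `\` G))%E.
  by rewrite -measureU// ?setUIDK// setDE setIACA setICr setI0.
rewrite (subset_measure0 mEC _ _ PC0) ?adde0//; first exact: measurableC.
Qed.

Lemma lawE (N : T -> nat) k : (forall k, measurable [set w | N w = k]) ->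
  (law P N k)%:E = P [set w | N w = k].
Proof. by move=> mN; rewrite /law fineK// fin_num_measure. Qed.

Lemma law_subprob (N : T -> nat) : (forall k, measurable [set w | N w = k]) ->
  subprob (law P N).
Proof.
move=> mN; split=> [k|]; first by rewrite -lee_fin lawE.
under eq_eseriesr do rewrite lawE//.
have := measure_partition P mN measurableT; rewrite probability_setT => ->.
by apply: lee_nneseries => // k _; rewrite setTI.
Qed.

Lemma measurable_diff (M N : T -> nat) (z : int) :
  (forall k, measurable [set w | M w = k]) -> (forall k, measurable [set w | N w = k]) ->
  measurable [set w | (M w)%:Z - (N w)%:Z = z].
Proof.
move=> mM mN; rewrite (_ : [set _ | _] = \bigcup_i \bigcup_(j in [set j : nat | i%:Z - j%:Z = z])
    ([set w | M w = i] `&` [set w | N w = j])).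
  by apply: bigcup_measurable => i _; apply: bigcup_measurable => j _; exact: measurableI.
apply/seteqP; split => w /=.
  by move=> h; exists (M w) => //; exists (N w).
by move=> [i _ [j /= h [-> ->]]].
Qed.

End RandomNaturals.

(** * Reduction to nondecreasing times *)

Section SortTimes.
Local Open Scope classical_set_scope.
Context {R : realType} {d d' : measure_display}
  {T : measurableType d} {T' : measurableType d'}.

(** The event is a finite conjunction, so sorting the pairs (time, value) by time leaves it
    unchanged. *)
Lemma fdd_eq_nondecreasing (P : probability T R) (X : R -> T -> nat)
    (Q : probability T' R) (Y : R -> T' -> nat) :
  (forall (n : nat) (t : nat -> R) (k : nat -> nat),
    0 <= t 0%N -> (forall i, t i <= t i.+1) ->
    P [set w | forall i, (i < n)%N -> X (t i) w = k i]
    = Q [set w | forall i, (i < n)%N -> Y (t i) w = k i]) ->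
  fdd_eq P X Q Y.
Proof.
move=> PQ n t k t0.
pose s := [seq (t i, k i) | i <- iota 0 n].
pose leT (x y : R * nat) := x.1 <= y.1.
pose s' := sort leT s.
(* With the last pair as default, the times stay constant past the end of the list, hence
   nondecreasing over all indices. *)
pose x0 := last (0, 0%N) s'.
have sorted_event (S : Type) (W : R -> S -> nat) :
    [set w | forall i, (i < n)%N -> W (t i) w = k i] =
    [set w | forall i, (i < n)%N -> W (nth x0 s' i).1 w = (nth x0 s' i).2].
  have size_s' : size s' = n by rewrite size_sort size_map size_iota.
  pose ok w := [pred x : R * nat | W x.1 w == x.2].
  apply/seteqP; split => w /= h.
    have : all (ok w) s'.
      rewrite all_sort; apply/allP => _ /mapP[i + ->].
      by rewrite mem_iota => /h /= ->.
    by move=> /(all_nthP x0); rewrite size_s' => + i ilt => /(_ i ilt)/eqP.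
  have : all (ok w) s'.
    by apply/(all_nthP x0); rewrite size_s' => i ilt; apply/eqP/h.
  rewrite all_sort => /allP + i ilt => /(_ (t i, k i)) /= /(_ _)/eqP; apply.
  by apply/mapP; exists i => //; rewrite mem_iota.
rewrite !sorted_event; apply: PQ.
  have s'0 x : x \in (0, 0%N) :: s' -> 0 <= x.1.
    rewrite inE => /predU1P[->//|]; rewrite mem_sort => /mapP[i _ ->]; exact: t0.
  case: (ltnP 0 (size s')) => [h|h]; first by apply: s'0; rewrite inE mem_nth ?orbT.
  by rewrite nth_default// s'0// mem_last.
move=> i; case: (ltnP i.+1 (size s')) => [h|h].
  have /(sortedP x0) : sorted leT s' by apply: sort_sorted => x y; exact: le_total.
  exact.
rewrite [in leRHS]nth_default//.
move: h; rewrite leq_eqVlt => /predU1P[e|h]; last by rewrite nth_default.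
have -> : i = (size s').-1 by rewrite e.
by rewrite nth_last /x0; case: s' e {sorted_event x0}.
Qed.

End SortTimes.

(** * Finite-dimensional laws and generating functions of the process *)

Section LevyNat.
Local Open Scope classical_set_scope.
Context {R : realType} {d : measure_display} {T : measurableType d}.
Variables (P : probability T R) (X : R -> T -> nat).
Hypothesis hX : levy_nat P X.

Definition prev_time (t : nat -> R) (i : nat) : R := if i is j.+1 then t j else 0.

Let mX t k : measurable [set w | X t w = k].
Proof. exact: (levy_meas hX). Qed.

Let lawXE t k : (law P (X t) k)%:E = P [set w | X t w = k].
Proof. by apply: lawE => j; exact: mX. Qed.

Lemma law_levy_subprob t : subprob (law P (X t)).
Proof. by apply: law_subprob => j; exact: mX. Qed.

(** Time 0 is put in front. On the almost sure event X(0) = 0, prescribing the values is the same as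
    prescribing the increments, which are independent and stationary. *)
Lemma levy_fdd n (t : nat -> R) (k : nat -> nat) :
  0 <= t 0%N -> (forall i, t i <= t i.+1) ->
  P [set w | forall i, (i < n)%N -> X (t i) w = k i] =
  (\prod_(i < n) delay (law P (X (t i - prev_time t i))) (prev_val k i) (k i))%:E.
Proof.
move=> t0 tS; pose t' := prev_time t.
have t'S i : t' i <= t' i.+1 by case: i.
have t'0 i : 0 <= t' i.
  by elim: i => [|i IHi]; rewrite ?lexx// (le_trans IHi).
pose z i : int := (k i)%:Z - (prev_val k i)%:Z.
have mG : measurable [set w | X 0 w = 0%N] by [].
pose F := [set w | forall i, (i < n)%N -> (X (t' i.+1) w)%:Z - (X (t' i) w)%:Z = z i].
have mF : measurable F.
  by apply: measurable_forall_lt => i; exact: measurable_diff.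
transitivity (P F).
  have mE := measurable_forall_lt n (fun i => mX (t i) (k i)).
  rewrite -(probability_setI1 mE mG (levy_0 hX)) -(probability_setI1 mF mG (levy_0 hX)).
  congr (P _); apply/seteqP; split => w [/= h X0]; split => //.
    move=> i ilt; rewrite (h i ilt) /z; congr (_ - _).
    by case: i ilt => [|i] ilt /=; rewrite ?X0// h// ltnW.
  elim=> [|i IHi] ilt; have := h _ ilt; rewrite /z /t' /=.
    by rewrite X0 !subr0 => -[].
  by rewrite IHi 1?ltnW// => /addIr[].
rewrite /F (levy_indep hX n z (t'0 0%N) t'S).
rewrite -prodEFin; apply: eq_bigr => i _.
rewrite (levy_stat hX (z i) (t'0 i) (t'S i)) /delay /z /=.
case: ifP => [ki|/negbT ki].
  rewrite lawXE; congr (P _); apply/seteqP; split => w /=.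
    by rewrite subzn// => -[].
  by move=> ->; rewrite subzn.
(* By stationarity a negative increment would have to be a value of the process itself, which is a
   natural number. *)
rewrite (_ : [set _ | _] = set0) ?measure0//; apply/seteqP; split => w //= h.
by move: ki; rewrite -ltnNge -ltz_nat -subr_lt0 -h.
Qed.

Lemma law_levyD t u k : 0 <= t -> 0 <= u ->
  (law P (X (t + u)) k)%:E =
  (\sum_(i <oo) (law P (X t) i * delay (law P (X u)) i k)%:E)%E.
Proof.
move=> t0 u0; rewrite lawXE (measure_partition P (mX t) (mX _ _)).
apply: eq_eseriesr => i _.
have := @levy_fdd 2 (fun j => if j is 0%N then t else t + u)
  (fun j => if j is 0%N then i else k) t0.
rewrite big_ord_recl big_ord1/= subr0 addrAC subrr add0r {1}/delay leq0n subn0 => <-.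
  congr (P _); apply/seteqP; split => w /=; first by move=> [h1 h2] [|[|]].
  by move=> h; split; [exact: (h 1%N)|exact: (h 0%N)].
by case=> [|j]//; rewrite lerDl.
Qed.

Lemma pgf_levyD s t u : 0 <= s <= 1 -> 0 <= t -> 0 <= u ->
  pgf (law P (X (t + u))) s = pgf (law P (X t)) s * pgf (law P (X u)) s.
Proof.
move=> s01 t0 u0; apply: pgf_conv; rewrite ?s01//; try exact: law_levy_subprob.
by move=> k; exact: law_levyD.
Qed.

(* Continuity in probability at time 0 is what excludes P(X t = 0) = 0. *)
Lemma law_levy0_gt0_near0 :
  exists2 e : R, 0 < e & forall t, 0 <= t < e -> 0 < law P (X t) 0%N.
Proof.
(* Tolerance 1 suffices: P(X(t) = 0) = 0 would give P(X(t) <> X(0)) = 1. *)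
have [e e0 he] := levy_cont hX (lexx 0) (@ltr01 R).
exists e => // t /andP[t0 te].
have := he t t0; rewrite subr0 ger0_norm// => /(_ te).
move=> hlt; rewrite lt0r (subprob_ge0 0%N (law_levy_subprob t)) andbT.
apply: contraTneq hlt => p0; rewrite -leNgt.
have PC : P (~` [set w | X t w = 0%N]) = 1%E.
  by rewrite probability_setC// -lawXE p0 sube0.
rewrite -PC -(probability_setI1 _ (mX 0 0) (levy_0 hX)); last exact: measurableC.
apply: le_measure; rewrite ?inE.
- exact/measurableI/mX/measurableC.
- rewrite (_ : [set _ | _] = ~` [set w | (X t w)%:Z - (X 0 w)%:Z = 0]).
    exact/measurableC/measurable_diff.
  apply/seteqP; split => w /= h; apply: contra_not h.
    by move=> /subr0_eq[].
  by move=> ->; rewrite subrr.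
- by move=> w /= [h ->].
Qed.

(** Cut t into n steps shorter than e: each step has generating function at least P(X(t / n) = 0) >
    0, and their product is the value at t. *)
Lemma pgf_levy_gt0 s t : 0 <= s <= 1 -> 0 <= t -> 0 < pgf (law P (X t)) s.
Proof.
move=> s01 t0; have [e e0 he] := law_levy0_gt0_near0.
have te0 : 0 <= t / e by rewrite divr_ge0// ltW.
have /andP[_ hn] := truncn_itv te0; set n := (Num.truncn _).+1 in hn.
have n0 : 0 < n%:R :> R by rewrite ltr0n.
have tn0 : 0 <= t / n%:R by rewrite divr_ge0// ltW.
have tne : t / n%:R < e by rewrite ltr_pdivrMr// mulrC -ltr_pdivrMr.
have step : 0 < pgf (law P (X (t / n%:R))) s.
  apply: lt_le_trans (pgf_ge_coef0 (law_levy_subprob _) s01).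
  by apply: he; rewrite tn0.
have pos m : 0 < pgf (law P (X (m.+1%:R * (t / n%:R)))) s.
  elim: m => [|m IHm]; first by rewrite mul1r.
  by rewrite -[m.+2]addn1 natrD mulrDl mul1r pgf_levyD ?mulr_gt0// mulr_ge0.
by have := pos n.-1; rewrite prednK// mulrC divfK// gt_eqF.
Qed.

Lemma pgf_levyE s t : 0 <= s <= 1 -> 0 <= t ->
  pgf (law P (X t)) s = pgf (law P (X 1)) s `^ t.
Proof.
move=> s01; apply: (@multiplicative_powR R (fun t => pgf (law P (X t)) s)).
  by move=> u u0; rewrite pgf_levy_gt0// pgf_le1//; exact: law_levy_subprob.
by move=> u v u0 v0; exact: pgf_levyD.
Qed.

Section ThinnedCopy.
Context {d' : measure_display} {T' : measurableType d'}.
Variables (Q : probability T' R) (X' : R -> T' -> nat) (Z : nat -> T' -> bool) (c : R).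
Hypotheses (c01 : 0 <= c <= 1)
  (mX' : forall t k, measurable [set w | X' t w = k])
  (mZ : forall i, measurable [set w | Z i w])
  (XX' : fdd_eq P X Q X') (hZ : bern_indep Q c X' Z).

(** The counterpart of [levy_fdd] with thinned step laws. The right-hand side depends only on the
    law of X and on c, so every realisation gives the same answer. *)
Lemma thin_proc_fdd n (t : nat -> R) (k : nat -> nat) :
  0 <= t 0%N -> (forall i, t i <= t i.+1) ->
  Q [set w | forall i, (i < n)%N -> thin_proc X' Z (t i) w = k i] =
  (\prod_(i < n)
    delay (thin_law c (law P (X (t i - prev_time t i)))) (prev_val k i) (k i))%:E.
Proof.
move=> t0 tS.
have t_ge0 i : 0 <= t i by elim: i => // i IHi; exact: le_trans (tS i).
apply: (@thin_fdd _ _ _ Q c Z c01 mZ n (fun i => X' (t i))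
  (fun i => law P (X (t i - prev_time t i)))) => //.
- by move=> i; exact: law_levy_subprob.
- by move=> x; rewrite -levy_fdd// XX'.
- move=> x; split=> [|l b]; first by apply: measurable_forall_lt => i; exact: mX'.
  exact: hZ.
Qed.

End ThinnedCopy.

End LevyNat.

(** * A probability space carrying the Bernoulli sequence *)

Section BernoulliDigits.
Local Open Scope classical_set_scope.
Variables (R : realType) (c : R).
Hypothesis c01 : 0 < c < 1.

(* [0, c[ and [c, 1[ are each stretched onto [0, 1[, so that under Lebesgue
   measure the successive digits are independent Bernoulli(c). *)
Definition digit_shift (x : R) : R := if x < c then x / c else (x - c) / (1 - c).

Definition digit (i : nat) (x : R) : bool := iter i digit_shift x < c.

(** Within [0, 1[ a cylinder is a half-open interval whose length is the required probability. *)
Lemma digit_cylinder m (b : nat -> bool) : exists2 lo : R,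
  0 <= lo /\ lo + \prod_(i < m) (if b i then c else 1 - c) <= 1 &
  forall x, 0 <= x < 1 -> ((forall i, (i < m)%N -> digit i x = b i) <->
    lo <= x < lo + \prod_(i < m) (if b i then c else 1 - c)).
Proof.
have /andP[c0 c1] := c01.
elim: m b => [|m IHm] b.
  by exists 0; rewrite big_ord0 add0r// => x ->.
have [lo [lo0 lo1] hlo] := IHm (fun i => b i.+1).
rewrite big_ord_recl/=.
under eq_bigr do rewrite /bump/= add1n.
set L := \prod_(i < m) _ in lo1 hlo *.
have hS x : (forall i, (i < m.+1)%N -> digit i x = b i) <->
    (x < c) = b 0%N /\ forall i, (i < m)%N -> digit i (digit_shift x) = b i.+1.
  split=> [h|[h0 h] [|i] im //].
    by split=> [|i im]; [exact: (h 0%N)|rewrite -(h i.+1)// /digit -iterSr].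
  by rewrite -h// /digit -iterSr.
(* The left endpoint for the remaining digits is pulled back through the affine branch of
   [digit_shift] chosen by the first digit. *)
case b0: (b 0%N); [exists (c * lo)|exists (c + (1 - c) * lo)].
- by split; nra.
- move=> x /andP[x0 x1]; rewrite hS b0 /digit_shift.
  have y01 : x < c -> 0 <= x / c < 1.
    by move=> xc; rewrite divr_ge0 ?ltr_pdivrMr ?mul1r ?xc// ltW.
  have hx : lo <= x / c < lo + L <-> c * lo <= x < c * lo + c * L.
    rewrite ler_pdivlMr// ltr_pdivrMr// -mulrDr ![_ * c]mulrC.
    by split.
  split=> [[xc]|h]; first by rewrite xc => /(hlo _ (y01 xc))/hx.
  have xc : x < c by case/andP: h => h1 h2; nra.
  by rewrite xc; split => //; apply/(hlo _ (y01 xc))/hx.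
- by split; nra.
- have c'0 : 0 < 1 - c by rewrite subr_gt0.
  move=> x /andP[x0 x1]; rewrite hS b0 /digit_shift.
  have y01 : c <= x -> 0 <= (x - c) / (1 - c) < 1.
    move=> xc; rewrite ltr_pdivrMr// mul1r ltrD2r x1 andbT.
    by rewrite divr_ge0 ?subr_ge0// ltW.
  have hx : lo <= (x - c) / (1 - c) < lo + L <->
      c + (1 - c) * lo <= x < c + (1 - c) * lo + (1 - c) * L.
    rewrite ler_pdivlMr// ltr_pdivrMr// lerBrDl ltrBlDl -addrA -mulrDr ![_ * (1 - c)]mulrC.
    by split.
  split=> [[]|h].
    by rewrite ltNge => /negbFE xc; rewrite xc => /(hlo _ (y01 xc))/hx.
  have xc : c <= x by case/andP: h => h1 h2; nra.
  by rewrite ltNge xc; split => //; apply/(hlo _ (y01 xc))/hx.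
Qed.

Let U : probability _ R := uniform_prob (@ltr01 R).

Lemma uniform_prob01_itv (lo hi : R) : 0 <= lo -> lo <= hi -> hi <= 1 ->
  U `[lo, hi[%classic = (hi - lo)%:E.
Proof.
move=> lo0 lohi hi1.
rewrite /U /= /uniform_prob integral_uniform_pdf.
have -> : `[lo, hi[%classic `&` `[0, 1]%classic = `[lo, hi[%classic :> set R.
  apply/setIidPl => x /=; rewrite !in_itv/= => /andP[h1 h2].
  by rewrite (le_trans lo0 h1) (le_trans (ltW h2) hi1).
rewrite (eq_integral (fun=> 1%:E)) => [|x]; last first.
  rewrite inE/= in_itv/= /uniform_pdf => /andP[h1 h2].
  by rewrite (le_trans lo0 h1) (le_trans (ltW h2) hi1) subr0 invr1.
rewrite integral_cst//= mul1e lebesgue_measure_itv/= lte_fin.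
by case: ltgtP lohi => // -> _; rewrite subrr.
Qed.

Lemma measurable_iter_digit_shift i : measurable_fun setT (iter i digit_shift).
Proof.
have mshift : measurable_fun setT digit_shift.
  apply: measurable_fun_ifT => /=.
  - by apply: measurable_fun_ltr.
  - rewrite (_ : (fun x => x / c) = id \* cst c^-1)//.
    by apply: measurable_funM.
  - rewrite (_ : (fun x => (x - c) / (1 - c)) = (id \- cst c) \* cst (1 - c)^-1)//.
    by apply: measurable_funM => //; apply: measurable_funB.
elim: i => [|i IHi]; first exact: measurable_id.
exact: measurableT_comp mshift IHi.
Qed.

Lemma measurable_digit i v : measurable [set x | digit i x = v].
Proof.
rewrite (_ : [set _ | _] = (iter i digit_shift) @^-1`
  (if v then `]-oo, c[%classic else `[c, +oo[%classic)).
  rewrite -[_ @^-1` _]setTI; apply: measurable_iter_digit_shift => //.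
  by case: v; exact: measurable_itv.
apply/seteqP; rewrite /digit; split => x /=; case: v; rewrite /= in_itv/= ?andbT//.
- by rewrite ltNge => /negbFE.
- by move=> h; rewrite ltNge h.
Qed.

Lemma digit_iid m (b : nat -> bool) :
  U [set x | forall i, (i < m)%N -> digit i x = b i] =
  (\prod_(i < m) (if b i then c else 1 - c))%:E.
Proof.
have [lo [lo0 lo1] hlo] := digit_cylinder m b.
(* Cylinders are known only inside [0, 1[, which carries the full mass. *)
have U01 : U `[0, 1[%classic = 1%E by rewrite uniform_prob01_itv// subr0.
have mE : measurable [set x | forall i, (i < m)%N -> digit i x = b i].
  by apply: measurable_forall_lt => i; exact: measurable_digit.
set E := [set x | _] in mE *.
have <- : U (E `&` `[0, 1[%classic) = U E.
  by apply: probability_setI1 => //; exact: measurable_itv.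
have L0 : 0 <= \prod_(i < m) (if b i then c else 1 - c).
  by apply: prodr_ge0 => i _; case/andP: c01 => c0 c1; case: (b i); rewrite ?subr_ge0 ltW.
rewrite -[in RHS](addKr lo (\prod_(i < m) _)) [- lo + _]addrC -uniform_prob01_itv ?lerDl//.
congr (U _); apply/seteqP; split => x /=; rewrite !in_itv/=.
  by move=> [h x01]; exact/hlo.
move=> /[dup] h /andP[h1 h2].
have x01 : 0 <= x < 1 by rewrite (le_trans lo0 h1) (lt_le_trans h2 lo1).
by split => //; apply/hlo.
Qed.

End BernoulliDigits.

(** * A product space realising the thinning *)

Section Witness.
Local Open Scope classical_set_scope.
Context {R : realType} {d : measure_display} {T : measurableType d}.
Variables (P : probability T R) (X : R -> T -> nat) (c : R).
Hypotheses (mX : forall t k, measurable [set w | X t w = k]) (c01 : 0 < c < 1).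

Let U : probability _ R := uniform_prob (@ltr01 R).
Let Q : probability _ R := (P \x U)%E.

Lemma fdd_eq_fst : fdd_eq P X Q (fun t w => X t w.1).
Proof.
move=> n t k _.
have mE := measurable_forall_lt n (fun i => mX (t i) (k i)).
set E := [set w | _] in mE *; transitivity (P E * U setT)%E.
  by rewrite probability_setT mule1.
rewrite -product_measure1E//.
by congr (Q _); apply/seteqP; split => w /= => [[]|].
Qed.

Lemma bern_indep_snd : bern_indep Q c (fun t w => X t w.1) (fun i w => digit c i w.2).
Proof.
move=> n t k m b t0; rewrite -fdd_eq_fst// -digit_iid//.
have mE := measurable_forall_lt n (fun i => mX (t i) (k i)).
rewrite -product_measure1E//.
by apply: measurable_forall_lt => i; exact: measurable_digit.
Qed.

Lemma measurable_fst_level t k :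
  measurable [set w : T * g_sigma_algebraType (R.-ocitv.-measurable) | X t w.1 = k].
Proof.
rewrite (_ : [set _ | _] = [set w | X t w = k] `*` setT); first exact: measurableX.
by apply/seteqP; split => w /= => [|[]].
Qed.

Lemma measurable_snd_digit i :
  measurable [set w : T * g_sigma_algebraType (R.-ocitv.-measurable) | digit c i w.2].
Proof.
rewrite (_ : [set _ | _] = setT `*` [set x | digit c i x = true]).
  by apply: measurableX => //; exact: measurable_digit.
by apply/seteqP; split => w /= => [|[]].
Qed.

End Witness.

(** * Semi-selfsimilarity in terms of one-dimensional laws *)

Section SemiSelfSimilarity.
Local Open Scope classical_set_scope.
Context {R : realType} {d : measure_display} {T : measurableType d}.
Variables (P : probability T R) (X : R -> T -> nat) (a H : R).
Hypotheses (hX : levy_nat P X) (a0 : 0 < a) (aH01 : 0 < a `^ H < 1).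

Let c01 : 0 <= a `^ H <= 1.
Proof. by case/andP: aH01 => c0 c1; rewrite !ltW. Qed.

Let mX t k : measurable [set w | X t w = k].
Proof. exact: (levy_meas hX). Qed.

(** The universally quantified definition is applied to the product space, at the single time 1. *)
Lemma sss_law : sss P X a H ->
  law P (X a) =1 thin_law (a `^ H) (law P (X 1)).
Proof.
move=> hsss k.
pose Q : probability _ R := (P \x uniform_prob (@ltr01 R))%E.
have fddX : fdd_eq P X Q _ := fdd_eq_fst P mX.
have indZ : bern_indep Q _ _ _ := bern_indep_snd P mX aH01.
have mX' := measurable_fst_level mX; have mZ := @measurable_snd_digit R _ T (a `^ H).
have := hsss _ _ Q _ _ mX' mZ fddX indZ 1%N (fun=> 1) (fun=> k) (fun=> ler01).
rewrite (thin_proc_fdd hX c01 mX' mZ fddX indZ)// big_ord1 /= subr0.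
rewrite /delay leq0n subn0 => h; apply: EFin_inj; rewrite -h (lawE P k (mX a)) mulr1.
by congr (P _); apply/seteqP; split => w /= => [<- []|/(_ 0%N)->].
Qed.

(** Both joint laws are products over increments, and an increment of the times a t is a times that
    of t, so the factors agree one by one. *)
Lemma law_sss :
  (forall u, 0 <= u -> law P (X (a * u)) =1 thin_law (a `^ H) (law P (X u))) ->
  sss P X a H.
Proof.
move=> hlaw d' T' Q X' Z mX' mZ fddX indZ.
apply: fdd_eq_nondecreasing => n t k t0 tS.
rewrite (thin_proc_fdd hX c01 mX' mZ fddX indZ)//.
have := @levy_fdd _ _ _ _ _ hX n (fun i => a * t i) k.
rewrite mulr_ge0 ?(ltW a0)// => -> //; last by move=> i; rewrite ler_pM2l.
congr (_%:E); apply: eq_bigr => i _.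
have -> : a * t i - prev_time (fun j => a * t j) i = a * (t i - prev_time t i).
  by case: (nat_of_ord i) => [|j] /=; rewrite ?subr0// mulrBr.
rewrite /delay; case: ifP => // _; rewrite hlaw// subr_ge0.
by case: (nat_of_ord i) => [|j] /=.
Qed.

End SemiSelfSimilarity.

Unset Implicit Arguments.

Theorem theorem2p2 (R : realType) (d : measure_display) (T : measurableType d)
  (P : probability T R) (X : R -> T -> nat) (a alpha : R) :
  0 < a < 1 -> 0 < alpha <= 1 ->
  levy_nat P X ->
  (sss P X a (1 / alpha) <-> semistable (law P (X 1)) a (a `^ (1 / alpha))).
Proof.
move=> /andP[a0 a1] /andP[alpha0 _] hX.
have b01 : 0 < a `^ (1 / alpha) < 1.
  rewrite powR_gt0//= /powR gt_eqF// expR_lt1 pmulr_rlt0 ?divr_gt0//.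
  by rewrite ln_lt0// a0.
have /andP[b0 b1] := b01.
have b01' : 0 <= a `^ (1 / alpha) <= 1 by rewrite !ltW.
have sp t : subprob (law P (X t)) by exact: law_levy_subprob.
have arg01 s : 0 <= s <= 1 -> 0 <= 1 - a `^ (1 / alpha) + a `^ (1 / alpha) * s <= 1.
  by case/andP => s0 s1; apply/andP; split; nra.
split=> [hsss s s01|hss].
  split; first by rewrite gt_eqF// (pgf_levy_gt0 hX).
  rewrite -pgf_thin_law// -(pgf_levyE hX s01 (ltW a0)).
  by congr (pgf _ s); apply/funext; exact: sss_law.
apply: law_sss => // u u0; apply: pgf_inj => // [|s /andP[s0 s1]].
  exact: thin_law_subprob.
have s01 : 0 <= s <= 1 by rewrite ltW.
(* With phi the generating function of X(1), the claim is phi(s)^(a u) = phi(1 - b + b s)^u, the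
   u-th power of semi-stability. *)
rewrite pgf_thin_law// (pgf_levyE hX s01) ?mulr_ge0 ?(ltW a0)// (pgf_levyE hX (arg01 s s01) u0).
by rewrite -(hss s s01).2 powRrM.
Qed.
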